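(* Let $n,k,\ell$ be positive integers, and let $\Gamma=\mathrm{Cay}(\mathbb{Z}_n,\{x^k,x^{-k},x^\ell,x^{-\ell}\})$ be a connected circulant quartic graph. Then $\Gamma$ contains no $(4,0)$-regular set.
   Context: $\mathbb{Z}_n=\langle x\rangle$ denotes the cyclic group of order $n$, written multiplicatively. For a finite group $G$ with identity $e$ and an inverse-closed subset $S\subseteq G\setminus\{e\}$, the Cayley graph $\mathrm{Cay}(G,S)$ is the simple graph with vertex set $G$ in which $y$ and $z$ are adjacent if and only if $y^{-1}z\in S$. A circulant quartic graph is a graph $\mathrm{Cay}(\mathbb{Z}_n,\{x^k,x^{-k},x^\ell,x^{-\ell}\})$ where $x^k,x^{-k},x^\ell,x^{-\ell}$ are four distinct non-identity elements. For a graph $\Gamma$ and nonnegative integers $a,b$, a nonempty proper subset $C$ of $V(\Gamma)$ is an $(a,b)$-regular set of $\Gamma$ if every vertex in $C$ has exactly $a$ neighbours in $C$ and every vertex in $V(\Gamma)\setminus C$ has exactly $b$ neighbours in $C$. *)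

(* Defs.v *)
From mathcomp Require Import all_boot all_fingroup.

Set Implicit Arguments.
Unset Strict Implicit.
Unset Printing Implicit Defensive.

Local Open Scope group_scope.

(* A finite simple graph is a symmetric irreflexive relation on a finType. *)

Definition connected_graph (T : finType) (adj : rel T) : Prop :=
  forall u v : T, connect adj u v.

Definition neighbours_in (T : finType) (adj : rel T) (v : T) (C : {set T}) :
    {set T} :=
  [set w in C | adj v w].

Definition regular_set (T : finType) (adj : rel T) (a b : nat) (C : {set T}) :
    Prop :=
  [/\ C != set0,
      C \proper [set: T],
      forall v : T, v \in C -> #|neighbours_in adj v C| = a
    & forall v : T, v \notin C -> #|neighbours_in adj v C| = b].

Definition Cay (gT : finGroupType) (S : {set gT}) : rel gT :=
  fun y z => y^-1 * z \in S.

Lemma Cay_sym (gT : finGroupType) (S : {set gT}) :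
  (forall s, s \in S -> s^-1 \in S) -> symmetric (Cay S).
Proof.
move=> SV y z; rewrite /Cay.
by apply/idP/idP => /SV; rewrite invMg invgK.
Qed.

Lemma Cay_irr (gT : finGroupType) (S : {set gT}) :
  1 \notin S -> irreflexive (Cay S).
Proof. by move=> S1 y; rewrite /Cay mulVg; apply/negbTE. Qed.

Definition circulant_set (gT : finGroupType) (x : gT) (k l : nat) : {set gT} :=
  [set x ^+ k; x ^- k; x ^+ l; x ^- l].

Definition distinct_nonidentity (gT : finGroupType) (x : gT) (k l : nat) : bool :=
  uniq [:: 1; x ^+ k; x ^- k; x ^+ l; x ^- l].

Lemma circulant_setV (gT : finGroupType) (x : gT) (k l : nat) (s : gT) :
  s \in circulant_set x k l -> s^-1 \in circulant_set x k l.
Proof.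
by rewrite !inE => /orP[/orP[/orP[]|]|] /eqP->; rewrite ?invgK eqxx ?orbT.
Qed.

Lemma circulant_set1 (gT : finGroupType) (x : gT) (k l : nat) :
  distinct_nonidentity x k l -> 1 \notin circulant_set x k l.
Proof. by rewrite /distinct_nonidentity /= !inE -!orbA => /andP[]. Qed.

(* Main.v *)
Require Import Defs.
From mathcomp Require Import all_boot all_fingroup.

(** The second parameter of a regular set being 0 says that no edge leads from
    the complement of the set into it, so a walk that starts outside the set
    never enters it.  In a connected graph every vertex is reached by such a
    walk, hence the set is empty or everything, and a regular set is neither.
    [connect_notin_no_entry] is the claim about walks, and
    [connected_no_regular_set0] draws the conclusion for connected graphs. *)

Set Implicit Arguments.
Unset Strict Implicit.
Unset Printing Implicit Defensive.

Local Open Scope group_scope.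

Lemma connect_notin_no_entry (T : finType) (adj : rel T) (C : {set T}) :
  (forall v, v \notin C -> #|neighbours_in adj v C| = 0) ->
  forall u v, u \notin C -> connect adj u v -> v \notin C.
Proof.
move=> C0 u v uC /connectP[p adj_p ->] {v}.
elim: p u uC adj_p => //= w p IHp u uC /andP[adj_uw adj_p].
apply: IHp adj_p; apply/negP => wC.
by have /cards0_eq/setP/(_ w) := C0 u uC; rewrite !inE wC adj_uw.
Qed.

Lemma connected_no_regular_set0 (T : finType) (adj : rel T) (a : nat)
    (C : {set T}) :
  connected_graph adj -> ~ regular_set adj a 0 C.
Proof.
move=> conn [/set0Pn[v vC] /properP[_ [u _ uC]] _ C0].
by move: (connect_notin_no_entry C0 uC (conn u v)); rewrite vC.
Qed.

Theorem corollary5p5 (n k l : nat) (gT : finGroupType) (x : gT)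
    (n_gt0 : (0 < n)%N) (k_gt0 : (0 < k)%N) (l_gt0 : (0 < l)%N)
    (gen_x : <[x]> = [set: gT]) (ord_x : #[x] = n)
    (quartic : distinct_nonidentity x k l)
    (conn : connected_graph (Cay (circulant_set x k l))) :
  ~ exists C : {set gT}, regular_set (Cay (circulant_set x k l)) 4 0 C.
Proof. by case=> C; apply: connected_no_regular_set0. Qed.
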